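(* Let $n\ge 1$, $p\in[0,1)$, and $q_1,\dots,q_n\in[0,1]$ with $q_1+\dots+q_n=1$. Let $G$ be the linear grammar, i.e. the probabilistic context-free grammar with start symbol $E$, non-terminals $\{E,V\}$, terminals $\{\texttt{c},\texttt{+},\texttt{x}_1,\dots,\texttt{x}_n\}$ and rules $$E\to E\,\texttt{+}\,\texttt{c}V\ [p]\ \mid\ \texttt{c}\ [1-p],\qquad V\to \texttt{x}_1\ [q_1]\mid\dots\mid \texttt{x}_n\ [q_n].$$ Let $1\le r_1<\dots<r_k\le n$ with $k\ge 0$ and let $w=\texttt{c + c}\,\texttt{x}_{r_1}\texttt{ + }\cdots\texttt{ + c}\,\texttt{x}_{r_k}\in L(G)$. Then $$P([w])=\sum_{I\subseteq\{1,\dots,k\}}(-1)^{|I|}\,\frac{1-p}{1-p\sum_{i\in\{1,\dots,k\}\setminus I}q_{r_i}}.$$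
   Context: In a probabilistic context-free grammar the bracketed number after a rule is its probability. A parse tree has root the start symbol, leaves terminals, and the children of an internal node $A$ are, in order, the symbols of the right-hand side of some rule for $A$; its string is the left-to-right sequence of its leaves, its probability is the product, with multiplicity, of the probabilities of the rules used. $L(G)$ is the set of derivable terminal strings, and $P(v)$ is the sum of the probabilities of all parse trees with string $v$. For $v\in L(G)$ with exactly $m$ occurrences of $\texttt{c}$ and $c_1,\dots,c_m\in\mathbb R$, let $f_{v,c_1,\dots,c_m}:\mathbb R^n\to\mathbb R$ be the function of $(x_1,\dots,x_n)$ obtained by replacing the $i$-th occurrence of $\texttt{c}$ with $c_i$ and $\texttt{x}_j$ with $x_j$. Let $\Phi(v)=\{f_{v,c_1,\dots,c_m}: c_1,\dots,c_m\in\mathbb R\}$, $v\sim w$ iff $\Phi(v)=\Phi(w)$, $[w]=\{v\in L(G): v\sim w\}$, and $P([w])=\sum_{v\in[w]}P(v)$. *)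

(* Defs.v *)
From HB Require Import structures.
From mathcomp Require Import all_boot all_order all_algebra.
From mathcomp Require Import all_classical all_reals all_analysis.

Set Implicit Arguments.
Unset Strict Implicit.
Unset Printing Implicit Defensive.

Import Order.TTheory GRing.Theory Num.Theory.
Local Open Scope classical_set_scope.
Local Open Scope ring_scope.

(* A symbol is [inl A] for a nonterminal [A] and [inr a] for a terminal [a].
   [rules] lists the triples (left-hand side, right-hand side, weight). *)
Record wcfg (R : Type) (N T : Type) := WCFG {
  start : N;
  rules : seq (N * seq (N + T) * R) }.

Definition is_rule (R : Type) (N T : eqType) (G : wcfg R N T)
    (A : N) (s : seq (N + T)) : bool :=
  (A, s) \in [seq u.1 | u <- rules G].

(* The sum has at most one term when the rules of [G] are pairwise distinct. *)
Definition rule_prob (R : realType) (N T : eqType) (G : wcfg R N T)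
    (A : N) (s : seq (N + T)) : R :=
  \sum_(u <- rules G | u.1 == (A, s)) u.2.

Definition probabilistic (R : realType) (N T : eqType) (G : wcfg R N T) : Prop :=
  [/\ uniq [seq u.1 | u <- rules G],
      forall u, u \in rules G -> 0 <= u.2 &
      forall A : N, \sum_(u <- rules G | u.1.1 == A) u.2 = 1].

Inductive derives (R : Type) (N T : eqType) (G : wcfg R N T) :
    seq (N + T) -> seq (N + T) -> Prop :=
| derives_refl s : derives G s s
| derives_step (a b s t : seq (N + T)) (A : N) :
    is_rule G A s -> derives G (a ++ s ++ b) t ->
    derives G (a ++ inl A :: b) t.

(* Derivability only depends on which rules are present: rules of probability
   zero may be used. *)
Definition language (R : Type) (N T : eqType) (G : wcfg R N T) : set (seq T) :=
  [set v | derives G [:: inl (start G)] [seq inr a | a <- v]].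

Inductive tree (N T : Type) :=
| Leaf of T
| Node of N & seq (tree N T).

HB.instance Definition _ (N T : Type) := gen_eqMixin (tree N T).
HB.instance Definition _ (N T : Type) := gen_choiceMixin (tree N T).

Definition root_symbol (N T : Type) (t : tree N T) : N + T :=
  match t with Leaf a => inr a | Node A _ => inl A end.

Fixpoint yield (N T : Type) (t : tree N T) : seq T :=
  match t with
  | Leaf a => [:: a]
  | Node _ ts => flatten [seq yield u | u <- ts]
  end.

Fixpoint follows_rules (R : Type) (N T : eqType) (G : wcfg R N T)
    (t : tree N T) : bool :=
  match t with
  | Leaf _ => true
  | Node A ts =>
      is_rule G A [seq root_symbol u | u <- ts] && all (follows_rules G) ts
  end.

Fixpoint tree_prob (R : realType) (N T : eqType) (G : wcfg R N T)
    (t : tree N T) : R :=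
  match t with
  | Leaf _ => 1
  | Node A ts =>
      rule_prob G A [seq root_symbol u | u <- ts] *
      foldr (fun u x => tree_prob G u * x) 1 ts
  end.

Definition parse_trees (R : Type) (N T : eqType) (G : wcfg R N T)
    (v : seq T) : set (tree N T) :=
  [set t | [/\ root_symbol t = inl (start G), follows_rules G t & yield t = v]].

Definition string_prob (R : realType) (N T : eqType) (G : wcfg R N T)
    (v : seq T) : \bar R :=
  (\esum_(t in parse_trees G v) (tree_prob G t)%:E)%E.

Inductive nonterminal := NE | NV.

Inductive terminal (n : nat) := Tc | Tplus | Tx of 'I_n.
Arguments Tc {n}.
Arguments Tplus {n}.

Definition nonterminal_code (A : nonterminal) : bool :=
  if A is NE then true else false.
Definition nonterminal_decode (b : bool) : nonterminal :=
  if b then NE else NV.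
Lemma nonterminal_codeK : cancel nonterminal_code nonterminal_decode.
Proof. by case. Qed.
HB.instance Definition _ := Equality.copy nonterminal (can_type nonterminal_codeK).

Definition terminal_code (n : nat) (a : terminal n) : option (option 'I_n) :=
  match a with Tc => None | Tplus => Some None | Tx j => Some (Some j) end.
Definition terminal_decode (n : nat) (o : option (option 'I_n)) : terminal n :=
  match o with None => Tc | Some None => Tplus | Some (Some j) => Tx j end.
Lemma terminal_codeK (n : nat) : cancel (@terminal_code n) (@terminal_decode n).
Proof. by case. Qed.
HB.instance Definition _ (n : nat) :=
  Choice.copy (terminal n) (can_type (@terminal_codeK n)).

Definition linear_grammar (R : realType) (n : nat) (p : R) (q : 'I_n -> R) :
    wcfg R nonterminal (terminal n) :=
  WCFG NE
    ((NE, [:: inl NE; inr Tplus; inr Tc; inl NV], p)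
     :: (NE, [:: inr Tc], 1 - p)
     :: [seq (NV, [:: inr (Tx j)], q j) | j <- enum 'I_n]).

Lemma linear_grammar_probabilistic (R : realType) (n : nat) (p : R)
    (q : 'I_n -> R) :
  0 <= p < 1 -> (forall j, 0 <= q j <= 1) -> \sum_(j < n) q j = 1 ->
  probabilistic (linear_grammar p q).
Proof.
move=> /andP[p0 p1] q01 q1; split.
- rewrite /= -map_comp !inE /=; apply/and3P; split.
  + by apply/mapP => -[].
  + by apply/mapP => -[].
  + rewrite map_inj_uniq ?enum_uniq // => i j /=.
    by move=> [->].
- move=> u; rewrite !inE => /orP[/eqP->//|/orP[/eqP->|/mapP[j _ ->]]] /=.
  + by rewrite subr_ge0 ltW.
  + by case/andP: (q01 j).
- case; rewrite /= !big_cons /= big_map /=.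
  + by rewrite big_pred0 // addr0 addrC subrK.
  + by rewrite big_enum.
Qed.

(* Value at [x] of a string over the terminals, read as a sum of products: the
   successive occurrences of [Tc] are replaced with the successive entries of
   [cs], [Tx j] with the [j]-th coordinate of [x], juxtaposition is
   multiplication, and [acc] is the product of the factors of the current
   summand that have been read so far. *)
Fixpoint eval (R : realType) (n : nat) (x : 'rV[R]_n) (acc : R) (cs : seq R)
    (v : seq (terminal n)) : R :=
  match v with
  | [::] => acc
  | Tc :: v' => eval x (acc * head 0 cs) (behead cs) v'
  | Tx j :: v' => eval x (acc * x ord0 j) cs v'
  | Tplus :: v' => acc + eval x 1 cs v'
  end.

Definition fun_of (R : realType) (n : nat) (v : seq (terminal n))
    (cs : (count_mem Tc v).-tuple R) : 'rV[R]_n -> R :=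
  fun x => eval x 1 cs v.

Definition Phi (R : realType) (n : nat) (v : seq (terminal n)) :
    set ('rV[R]_n -> R) :=
  range (@fun_of R n v).
Arguments Phi R {n} v.

Definition equiv_class (R : realType) (n : nat)
    (G : wcfg R nonterminal (terminal n)) (w : seq (terminal n)) :
    set (seq (terminal n)) :=
  [set v | language G v /\ Phi R v = Phi R w].

Definition class_prob (R : realType) (n : nat)
    (G : wcfg R nonterminal (terminal n)) (w : seq (terminal n)) : \bar R :=
  (\esum_(v in equiv_class G w) string_prob G v)%E.

(* c + c x_(r 0) + ... + c x_(r k.-1) *)
Definition linear_word (n k : nat) (r : 'I_k -> 'I_n) : seq (terminal n) :=
  Tc :: flatten [seq [:: Tplus; Tc; Tx (r i)] | i <- enum 'I_k].

Lemma linear_word_in_language (R : realType) (n : nat) (p : R) (q : 'I_n -> R)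
    (k : nat) (r : 'I_k -> 'I_n) :
  language (linear_grammar p q) (linear_word r).
Proof.
rewrite /language /linear_word /=.
suff H (s : seq 'I_k) (b : seq (nonterminal + terminal n)) :
    derives (linear_grammar p q) (inl NE :: b)
      ([seq inr a | a <- Tc :: flatten [seq [:: Tplus; Tc; Tx (r i)] | i <- s]]
       ++ b).
  by have := H (enum 'I_k) [::]; rewrite cats0.
elim/last_ind: s b => [|s i IH] b.
  apply: (@derives_step _ _ _ _ [::] b [:: inr Tc]); last exact: derives_refl.
  by rewrite /is_rule /= !inE eqxx orbT.
apply: (@derives_step _ _ _ _ [::] b [:: inl NE; inr Tplus; inr Tc; inl NV]).
  by rewrite /is_rule /= !inE eqxx.
apply: (@derives_step _ _ _ _ [:: inl NE; inr Tplus; inr Tc] b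
          [:: inr (Tx (r i))]).
  rewrite /is_rule /= !inE /= -map_comp.
  by apply/mapP; exists (r i); rewrite ?mem_enum.
by have := IH ([:: inr Tplus; inr Tc; inr (Tx (r i))] ++ b);
  rewrite map_rcons flatten_rcons /= map_cat -catA.
Qed.

(* Main.v *)
(* Every string of the grammar is c + c x_(s_1) + ... + c x_(s_m) for a unique
   sequence s, has a single parse tree, and has probability
   (1 - p) * prod_l (p * q_(s_l)).  Choosing the constants realises all affine
   functions whose linear part is supported on the set of letters of s, so the
   class of the string is determined by that set.  Summing over the sequences of
   length m whose set of letters is exactly {r_1, ..., r_k} gives, by
   inclusion-exclusion, (1 - p) times an alternating sum of the powers
   (p * sum_(i not in I) q_(r_i)) ^ m; the sum over m is geometric. *)

Require Import Defs.
From mathcomp Require Import all_boot all_order all_algebra.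
From mathcomp Require Import all_classical all_reals all_analysis.
From mathcomp Require Import ring.

Import Order.TTheory GRing.Theory Num.Theory.
Local Open Scope ring_scope.

(** * Words of the grammar, coded by their sequences of letters *)

Definition affine_word {n : nat} (s : seq 'I_n) : seq (terminal n) :=
  Tc :: flatten [seq [:: Tplus; Tc; Tx j] | j <- s].
Arguments affine_word {n} s : simpl never.

Lemma affine_word_rcons n (s : seq 'I_n) j :
  affine_word (rcons s j) = affine_word s ++ [:: Tplus; Tc; Tx j].
Proof. by rewrite /affine_word map_rcons flatten_rcons. Qed.

Lemma linear_wordE n k (r : 'I_k -> 'I_n) : linear_word r = affine_word (codom r).
Proof. by rewrite /linear_word /affine_word /codom /image_mem -map_comp. Qed.

Lemma affine_word_inj n : injective (@affine_word n).
Proof.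
move=> s t [] ; elim: s t => [|i s IH] [|j t] //= [-> st].
by rewrite (IH _ st).
Qed.

Lemma count_affine_word n (s : seq 'I_n) :
  count_mem Tc (affine_word s) = (size s).+1.
Proof. by rewrite /affine_word /=; congr S; elim: s => //= j s ->. Qed.

(** * Functions realised by a word *)

Lemma eval_summands (R : realType) n (x : 'rV[R]_n) acc cs (s : seq 'I_n) :
  size cs = size s ->
  Defs.eval x acc cs (flatten [seq [:: Tplus; Tc; Tx j] | j <- s]) =
  acc + \sum_(u <- zip cs s) u.1 * x ord0 u.2.
Proof.
elim: s cs acc => [|j s IH] [|c cs] acc //=; first by rewrite big_nil addr0.
by move=> [scs]; rewrite IH // big_cons mul1r.
Qed.

Lemma collect_coefficients (R : realType) (T : finType) (cs : seq R) (s : seq T) :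
  exists2 b : T -> R, (forall j, j \notin s -> b j = 0) &
    forall x : T -> R, \sum_(u <- zip cs s) u.1 * x u.2 = \sum_j b j * x j.
Proof.
exists (fun j => \sum_(u <- zip cs s | u.2 == j) u.1) => [j|x].
  elim: s cs => [|i s IH] [|c cs]; rewrite ?big_nil // big_cons /=.
  by rewrite inE negb_or eq_sym => /andP[/negPf-> /IH->].
rewrite (partition_big snd xpredT) //=; apply: eq_bigr => j _.
by rewrite mulr_suml; apply: eq_bigr => u /eqP->.
Qed.

(* The coefficient b j is carried by the last occurrence of j in s. *)
Lemma distribute_coefficients (R : realType) (T : finType) (s : seq T) (b : T -> R) :
  (forall j, j \notin s -> b j = 0) ->
  exists2 cs, size cs = size s &
    forall x : T -> R, \sum_(u <- zip cs s) u.1 * x u.2 = \sum_j b j * x j.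
Proof.
elim: s b => [|i s IH] b b0.
  by exists [::] => // x; rewrite big_nil big1 // => j _; rewrite b0 ?mul0r.
(* The head occurrence of [i] takes all of [b i], so the tail is given coefficient zero at [i]. The
   carrier is thus the first occurrence of a letter, not the last. *)
have [|cs scs csE] := IH (fun j => if j == i then 0 else b j).
  by move=> j js; case: eqP => // /eqP ji; rewrite b0 // inE negb_or ji.
exists (b i :: cs) => [|x]; first by rewrite /= scs.
rewrite big_cons csE /= (bigD1 i) //= eqxx mul0r add0r [RHS](bigD1 i) //=.
by congr (_ + _); apply: eq_bigr => j /negPf->.
Qed.

(** The leading constant is free and becomes [a]; the others add up on the letters that they
    multiply. Order and repetitions in [s] leave no trace. *)
Lemma Phi_affine_word (R : realType) n (s : seq 'I_n) :
  Phi R (affine_word s) =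
  [set f | exists a, exists2 b : 'I_n -> R, (forall j, j \notin s -> b j = 0) &
             f = fun x : 'rV[R]_n => a + \sum_j b j * x ord0 j]%classic.
Proof.
apply/seteqP; split=> [_ [cs _ <-]|_ [a [b b0 ->]]].
  have := size_tuple cs; rewrite {2}count_affine_word.
  case csE: (val cs) => [|c ds] //= [sds].
  have [b b0 bE] := collect_coefficients R _ ds s.
  exists c, b => //; apply/funext => x.
  by rewrite /fun_of csE /= eval_summands // mul1r bE.
have [ds sds dsE] := distribute_coefficients R _ s b b0.
have sz : size (a :: ds) == count_mem Tc (affine_word s).
  by rewrite count_affine_word /= sds.
exists (Tuple sz) => //; apply/funext => x.
by rewrite /fun_of /= eval_summands // mul1r dsE.
Qed.

Lemma sub_Phi_affine_word (R : realType) n (s t : seq 'I_n) :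
  (Phi R (affine_word s) `<=` Phi R (affine_word t))%classic <-> {subset s <= t}.
Proof.
rewrite !Phi_affine_word; split=> [st j js|st f [a [b b0 ->]]]; last first.
  by exists a, b => // j jt; apply: b0; apply: contra jt => /st.
(* The [j]-th coordinate function separates the two sets when [j] is missing from [t]: evaluation at
   0 forces [a = 0], and then evaluation at the [j]-th basis vector gives [1 = 0]. *)
have [|a [b b0 bE]] := st (fun x : 'rV[R]_n => x ord0 j).
  exists 0, (fun i => (i == j)%:R) => [i|].
    by case: eqP => // ->; rewrite js.
  apply/funext => x; rewrite add0r (bigD1 j) //= eqxx mul1r big1 ?addr0 //.
  by move=> i /negPf->; rewrite mul0r.
apply/negPn/negP => jt; have bj := b0 j jt.
have := congr1 (@^~ 0) bE; rewrite mxE big1 => [/esym/eqP|i _]; last first.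
  by rewrite mxE mulr0.
rewrite addr0 => /eqP a0.
have := congr1 (@^~ (delta_mx ord0 j)) bE; rewrite mxE !eqxx a0 add0r big1.
  by move/eqP; rewrite oner_eq0.
move=> i _; rewrite mxE eqxx /=; case: eqP => [->|_]; rewrite ?mulr0 //.
by rewrite bj mul0r.
Qed.

Lemma eq_Phi_affine_word (R : realType) n (s t : seq 'I_n) :
  Phi R (affine_word s) = Phi R (affine_word t) <-> s =i t.
Proof.
split=> [st j|st]; last by apply/seteqP; split; apply/sub_Phi_affine_word => j; rewrite st.
by apply/idP/idP; apply: (sub_Phi_affine_word R _ _ _).1 => //; rewrite st.
Qed.

(** * Inclusion-exclusion over sets of letters *)

Lemma inclusion_exclusion_indicator (R : comNzRingType) (I T : finType) (r : I -> T)
    (s : seq T) : injective r ->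
  (all [in codom r] s && [forall i, r i \in s])%:R =
  \sum_(J : {set I}) (-1) ^+ #|J| * (all [in r @: ~: J] s)%:R :> R.
Proof.
move=> r_inj.
have prodb (P A : pred I) :
    \prod_(i | P i) (A i)%:R = [forall (i | P i), A i]%:R :> R.
  rewrite -big_andE.
  by elim/big_rec2: _ => // i b c _ ->; rewrite -natrM mulnb.
rewrite -mulnb natrM.
(* Expand the product over [i] of [1 - [r i \notin s]]; [J] collects the indices whose letters are
   avoided. *)
have -> : [forall i, r i \in s]%:R =
    \sum_(J : {set I}) (-1) ^+ #|J| * [forall (i | i \in J), r i \notin s]%:R :> R.
  rewrite -(prodb xpredT).
  have natr_negb (b : bool) : b%:R = - (~~ b)%:R + 1 :> R.
    by case: b; rewrite ?oppr0 ?add0r ?addNr.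
  under eq_bigr do rewrite natr_negb.
  rewrite bigA_distr; apply: eq_bigr => J _; rewrite -big_mkcond /=.
  rewrite prodrN -prodb; congr (_ ^+ _ * _).
rewrite mulr_sumr; apply: eq_bigr => J _; rewrite mulrCA -natrM mulnb.
congr (_ * _%:R); congr nat_of_bool.
apply/andP/allP => [[/allP sr /forall_inP Js] j js|sJ].
  have /codomP[i ji] := sr j js.
  rewrite ji imset_f // inE; apply: contraL js; rewrite ji; exact: Js.
split; [apply/allP => j /sJ/imsetP[i _ ->]; exact: codom_f|].
apply/forall_inP => i iJ; apply/negP => /sJ/imsetP[i' + /r_inj ii'].
by rewrite -ii' inE iJ.
Qed.

(** Distributivity: expanding the power gives a sum over functions from ['I_m] to [T] with values in
    [D], which are the tuples. *)
Lemma sum_tuple_prod (R : comNzRingType) (T : finType) (D : pred T) (w : T -> R) m :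
  \sum_(t : m.-tuple T | all D t) \prod_(j <- t) w j = (\sum_(j | D j) w j) ^+ m.
Proof.
rewrite -[in RHS](card_ord m) -prodr_const bigA_distr_big /=.
rewrite (reindex (fun f : {ffun 'I_m -> T} => [tuple f i | i < m])) /=; last first.
  exists (fun t => [ffun i => tnth t i]) => [f _|t _].
    by apply/ffunP => i; rewrite ffunE tnth_mktuple.
  by apply: eq_from_tnth => i; rewrite tnth_mktuple ffunE.
apply: eq_big => [f|f _].
  apply/allP/ffun_onP => fD => [i|_ /mapP[i _ ->]]; last exact: fD.
  by apply/fD/mapP; exists i; rewrite ?mem_enum.
by rewrite big_map big_enum.
Qed.

(** After the exchange of sums, a fixed [J] leaves all tuples over the letters [r i] with [i]
    outside [J], and these sum to an [m]-th power. *)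
Lemma sum_spanning_tuples (R : comNzRingType) (I T : finType) (r : I -> T)
    (w : T -> R) m : injective r ->
  \sum_(t : m.-tuple T | all [in codom r] t && [forall i, r i \in tval t])
     \prod_(j <- t) w j =
  \sum_(J : {set I}) (-1) ^+ #|J| * (\sum_(i | i \notin J) w (r i)) ^+ m.
Proof.
move=> r_inj; rewrite big_mkcond /=.
under eq_bigr => t _.
  rewrite -mulrb -mulr_natl (inclusion_exclusion_indicator R I T r) //.
  rewrite mulr_suml; over.
rewrite exchange_big /=; apply: eq_bigr => J _.
have -> : \sum_(i | i \notin J) w (r i) = \sum_(j in r @: ~: J) w j.
  rewrite big_imset /=; first by apply: eq_bigl => i; rewrite inE.
  by move=> i i' _ _; apply: r_inj.
rewrite -sum_tuple_prod mulr_sumr [RHS]big_mkcond; apply: eq_bigr => t _.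
by rewrite -mulrA mulr_natl mulrb; case: ifP; rewrite ?mulr0.
Qed.

(** * Sums over sequences and geometric series *)

Lemma esum_finType (R : realType) (T : finType) (P : pred T) (f : T -> \bar R) :
  (forall t, P t -> (0 <= f t)%E) ->
  \esum_(t in [set` P]%classic) f t = (\sum_(t | P t) f t)%E.
Proof.
move=> f0; rewrite esum_fset; last by move=> i; rewrite inE; apply: f0.
  rewrite (fsbig_fwiden (enum P)) ?enum_uniq //; first by rewrite big_enum.
    by move=> t; rewrite /= mem_enum.
  by move=> t [/=]; rewrite mem_enum.
exact: finite_finset.
Qed.

(** The sets of sequences of given length are disjoint and finite, and nonnegativity allows summing
    them one after another. *)
Lemma esum_seq_by_size (R : realType) (T : finType) (P : pred (seq T))
    (f : seq T -> \bar R) :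
  (forall s, (0 <= f s)%E) ->
  \esum_(s in [set` P]%classic) f s =
  (\sum_(0 <= m <oo) \sum_(t : m.-tuple T | P t) f t)%E.
Proof.
move=> f0.
have -> : [set` P]%classic = (\bigcup_m [set s | P s /\ size s = m])%classic.
  by apply/seteqP; split=> [s Ps|s [m _ []]] //; exists (size s).
rewrite nneseries_sum_bigcup //; last first.
  by move=> m m' _ _ [s [[_ <-] [_ <-]]].
apply: eq_eseriesr => m _; rewrite -esum_finType //.
apply: reindex_esum; split=> [t|t t' _ _|s [Ps /eqP sm]] /=.
- by rewrite size_tuple.
- exact: val_inj.
- by exists (Tuple sm).
Qed.

Lemma sum_geometric_eseries (R : realType) (I : finType) (a z : I -> R) :
  (forall i, 0 <= z i < 1) ->
  (\sum_(0 <= m <oo) (\sum_i a i * z i ^+ m)%:E)%E = (\sum_i a i / (1 - z i))%:E.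
Proof.
move=> z01.
have cvg_s : ((fun m => \sum_i series (geometric (a i) (z i)) m)
    @ \oo --> \sum_i a i / (1 - z i))%classic.
  apply: cvg_big => [|i _]; first exact: add_continuous.
  apply: cvg_geometric_series; have /andP[z0 z1] := z01 i.
  by rewrite ger0_norm.
apply/cvg_lim => //; rewrite (_ : (fun m => _) =
  EFin \o (fun m => \sum_i series (geometric (a i) (z i)) m)).
  by apply: cvg_EFin => //; exact: nearW.
apply/funext => m /=; rewrite sumEFin; congr EFin.
by rewrite exchange_big.
Qed.

(** * Language, parse trees and string probabilities *)

Section Language.
Context {R : realType} {n : nat} {p : R} {q : 'I_n -> R}.
Let G := linear_grammar p q.

#[local] Arguments is_rule {R N T} G A s : simpl never.

Lemma is_rule_NE u :
  is_rule G NE u = (u == [:: inl NE; inr Tplus; inr Tc; inl NV]) || (u == [:: inr Tc]).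
Proof.
rewrite /is_rule /= !inE !xpair_eqE /= -map_comp; case: mapP => [[j _ []]|] //.
by rewrite orbF.
Qed.

Lemma is_rule_NV u :
  reflect (exists j, u = [:: inr (Tx j)]) (is_rule G NV u).
Proof.
rewrite /is_rule /= !inE !xpair_eqE /= -map_comp; apply: (iffP mapP).
  by move=> [j _ [->]]; exists j.
by move=> [j ->]; exists j; rewrite ?mem_enum.
Qed.

(** Direct reading of a sentential form: [NE] stands for any affine word and [NV] for any single
    variable. *)
Fixpoint generates (s : seq (nonterminal + terminal n)) (v : seq (terminal n)) : Prop :=
  match s with
  | [::] => v = [::]
  | inr a :: s' => exists2 v', v = a :: v' & generates s' v'
  | inl NE :: s' => exists u v', v = affine_word u ++ v' /\ generates s' v'
  | inl NV :: s' => exists j v', v = Tx j :: v' /\ generates s' v'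
  end.

Lemma generates_cat2l a s t v :
  (forall v, generates s v -> generates t v) -> generates (a ++ s) v -> generates (a ++ t) v.
Proof.
move=> st; elim: a v => [|[[]|a] A IH] v /=; first exact: st.
- by move=> [u [v' [-> /IH h]]]; exists u, v'.
- by move=> [u [v' [-> /IH h]]]; exists u, v'.
- by move=> [v' -> /IH h]; exists v'.
Qed.

(** Invariant read backwards along a derivation: whatever the right-hand side of a rule generates,
    its left-hand side generates too. *)
Lemma derives_generates s t v : derives G s t -> generates t v -> generates s v.
Proof.
move=> st; elim: st v => // a b u {}t A ru _ IH v /IH; apply: generates_cat2l.
move=> {IH} w; case: A ru => [|/is_rule_NV[j ->]] /=.
  rewrite is_rule_NE => /orP[]/eqP-> /=.
    move=> [x [y [-> [_ -> [_ -> [j [z [-> h]]]]]]]].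
    exists (rcons x j), z; split=> //.
    by rewrite -[RHS]/(affine_word _ ++ z) affine_word_rcons -catA.
  by move=> [y -> h]; exists [::], y.
by move=> [y -> h]; exists j, y.
Qed.

Lemma generates_refl v : generates [seq inr a | a <- v] v.
Proof. by elim: v => //= a v IH; exists v. Qed.

Lemma affine_word_language s : language G (affine_word s).
Proof.
have := @linear_word_in_language R n p q _ (tnth (in_tuple s)).
by rewrite linear_wordE codomE map_tnth_enum.
Qed.

Lemma languageE : language G = range affine_word.
Proof.
apply/seteqP; split=> [v /derives_generates/(_ (generates_refl v))|_ [s _ <-]].
  by move=> [u [v' [-> ->]]]; exists u; rewrite ?cats0.
exact: affine_word_language.
Qed.

(** The grammar is left-recursive, so the root carries the last summand: [s] lists the letters from
    right to left, whence the later uses of [rev]. *)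
Fixpoint linear_tree (s : seq 'I_n) : tree nonterminal (terminal n) :=
  if s is j :: s' then
    Node NE [:: linear_tree s'; Leaf _ Tplus; Leaf _ Tc; Node NV [:: Leaf _ (Tx j)]]
  else Node NE [:: Leaf _ Tc].

Lemma root_linear_tree s : root_symbol (linear_tree s) = inl NE.
Proof. by case: s. Qed.

Lemma yield_linear_tree s : yield (linear_tree s) = affine_word (rev s).
Proof. by elim: s => //= j s ->; rewrite rev_cons affine_word_rcons. Qed.

Lemma follows_linear_tree s : follows_rules G (linear_tree s).
Proof.
elim: s => [|j s IH] //=.
rewrite is_rule_NE root_linear_tree IH !andbT.
by apply/is_rule_NV; exists j.
Qed.

Lemma parse_linear_tree t : root_symbol t = inl NE -> follows_rules G t ->
  exists s, t = linear_tree s.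
Proof.
(* Explicit structural recursion, because the subtree [t1] sits inside the list of children. *)
move: t; fix IH 1 => -[a|[] ts] //= _ /andP[].
rewrite is_rule_NE => /orP[]/eqP.
  case: ts => [|t1 [|t2 [|t3 [|t4 [|? ?]]]]] //= [r1].
  case: t2 => // _ [->]; case: t3 => // _ [->]; case: t4 => // _ us [->] /=.
  move=> /and3P[/(IH _ r1)[s ->] + _] => /andP[/is_rule_NV[j]].
  by case: us => [|[?|? ?] [|? ?]] //= [->] _; exists (j :: s).
by case: ts => [|[?|? ?] [|? ?]] //= [->] _; exists [::].
Qed.

(** Unambiguity: a tree is determined by its letters, and these can be read off its yield. *)
Lemma parse_trees_affine_word s :
  parse_trees G (affine_word s) = [set linear_tree (rev s)]%classic.
Proof.
apply/seteqP; split=> [t [rt ft]|_ ->].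
  have [u ->] := parse_linear_tree _ rt ft.
  by rewrite yield_linear_tree => /affine_word_inj <-; rewrite revK.
by split; rewrite ?root_linear_tree ?follows_linear_tree ?yield_linear_tree ?revK.
Qed.

Lemma rule_prob_plus :
  rule_prob G NE [:: inl NE; inr Tplus; inr Tc; inl NV] = p.
Proof. by rewrite /rule_prob /= !big_cons big_map big_pred0 //= addr0. Qed.

Lemma rule_prob_const : rule_prob G NE [:: inr Tc] = 1 - p.
Proof. by rewrite /rule_prob /= !big_cons big_map big_pred0 //= addr0. Qed.

Lemma rule_prob_var j : rule_prob G NV [:: inr (Tx j)] = q j.
Proof.
rewrite /rule_prob /= !big_cons big_map /= big_enum_cond /=.
by rewrite (big_pred1 j) // => i /=; rewrite eq_sym; apply/eqP/eqP => [[->]|->].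
Qed.

Lemma tree_prob_linear_tree s :
  tree_prob G (linear_tree s) = (1 - p) * \prod_(j <- s) (p * q j).
Proof.
elim: s => [|j s IH]; first by rewrite /= rule_prob_const big_nil mulr1.
rewrite big_cons /= root_linear_tree rule_prob_plus rule_prob_var IH.
by rewrite !mulr1 !mul1r; ring.
Qed.

Lemma string_prob_affine_word s : 0 <= p <= 1 -> (forall j, 0 <= q j) ->
  string_prob G (affine_word s) = ((1 - p) * \prod_(j <- s) (p * q j))%:E.
Proof.
move=> /andP[p0 p1] q0; rewrite /string_prob parse_trees_affine_word.
rewrite esum_set1 tree_prob_linear_tree (perm_big s) ?perm_rev //=.
by rewrite lee_fin mulr_ge0 ?subr_ge0 ?prodr_ge0 // => j _; rewrite mulr_ge0.
Qed.

End Language.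

(** * The class of the word and its probability *)

Lemma equiv_class_linear_word (R : realType) n p (q : 'I_n -> R) k (r : 'I_k -> 'I_n) :
  Defs.equiv_class (linear_grammar p q) (linear_word r) =
  (affine_word @` [set` [pred s | all [in codom r] s & [forall i, r i \in s]]])%classic.
Proof.
apply/seteqP; split=> [v|_ [s + <-]].
  rewrite /Defs.equiv_class languageE linear_wordE => -[[s _ <-]] /eq_Phi_affine_word sr.
  exists s => //=; apply/andP; split; first by apply/allP => j; rewrite sr.
  by apply/forallP => i; rewrite sr codom_f.
move=> /= /andP[/allP sr /forallP rs]; split; first exact: affine_word_language.
rewrite linear_wordE; apply/eq_Phi_affine_word => j; apply/idP/idP; first exact: sr.
by move=> /codomP[i ->].
Qed.

Theorem mainTheorem2 (R : realType) (n : nat) (hn : (1 <= n)%N)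
    (p : R) (hp : 0 <= p < 1)
    (q : 'I_n -> R) (hq : forall j, 0 <= q j <= 1)
    (hq1 : \sum_(j < n) q j = 1)
    (k : nat) (r : 'I_k -> 'I_n)
    (hr : forall i j : 'I_k, (i < j)%N -> (r i < r j)%N) :
  class_prob (linear_grammar p q) (linear_word r) =
  (\sum_(I : {set 'I_k})
     (-1) ^+ #|I| * ((1 - p) / (1 - p * \sum_(i < k | i \notin I) q (r i))))%:E.
Proof.
have /andP[p0 p1] := hp.
have q0 j : 0 <= q j by case/andP: (hq j).
have r_inj : injective r.
  move=> i j rij.
  by case: (ltngtP i j) => [/hr|/hr|/val_inj //]; rewrite rij ltnn.
rewrite /class_prob equiv_class_linear_word esum_image; last first.
  by move=> s t _ _; apply: affine_word_inj.
rewrite (eq_esum (fun s _ => string_prob_affine_word s _ q0)) ?p0 ?ltW //.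
rewrite esum_seq_by_size => [|s]; last first.
  rewrite lee_fin mulr_ge0 ?subr_ge0 ?(ltW p1) // prodr_ge0 // => j _.
  exact: mulr_ge0.
pose z (J : {set 'I_k}) := p * \sum_(i | i \notin J) q (r i).
(* As [r] is injective, the [q (r i)] are weights of distinct letters, so they sum to at most 1 and
   [z J <= p < 1]. *)
have z01 J : 0 <= z J < 1.
  rewrite mulr_ge0 ?sumr_ge0 //=; apply: le_lt_trans p1.
  rewrite -[leRHS]mulr1 -hq1 ler_wpM2l //.
  rewrite -(big_imset q) /=; last by move=> i i' _ _; apply: r_inj.
  by rewrite [leLHS]big_mkcond ler_sum // => j _; case: ifP.
(* The total weight of length [m] is rewritten as a finite combination of the powers [z J ^+ m],
   ready for geometric summation. *)
rewrite -(eq_eseriesr (f := fun m => (\sum_(J : {set 'I_k}) (1 - p) * (-1) ^+ #|J| * z J ^+ m)%:E)).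
  rewrite sum_geometric_eseries //; congr EFin.
  by apply: eq_bigr => J _; rewrite mulrCA mulrA.
move=> m _; rewrite sumEFin -mulr_sumr sum_spanning_tuples // mulr_sumr.
by congr EFin; apply: eq_bigr => J _; rewrite -mulrA /z mulr_sumr.
Qed.
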